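(* Let $(T,X,\pi)$ be a topologically weakly-mixing semiflow on a non-singleton Polish space $X$ with discrete phase semigroup $T$. Then it is densely 2D Li-Yorke chaotic.
   Context: A topological semiflow $(T,X,\pi)$ consists of a topological semigroup $T$, a topological space $X$ and a jointly continuous map $\pi\colon T\times X\to X$, $(t,x)\mapsto tx$, with $s(tx)=(st)x$ for all $s,t\in T$, $x\in X$, and $ex=x$ for all $x$ if $T$ has a neutral element $e$. $T$ acts on $X\times X$ by $t(x,y)=(tx,ty)$. For nonempty open $U,V\subseteq X$ let $N_T(U,V)=\{t\in T : U\cap t^{-1}V\neq\emptyset\}$, $t^{-1}V=\{x : tx\in V\}$. The semiflow is topologically weakly-mixing if $N_T(U,V)\cap N_T(U',V')\neq\emptyset$ for all nonempty open $U,V,U',V'\subseteq X$ (equivalently, $(T,X\times X)$ is topologically transitive). $(T,X,\pi)$ is densely 2D Li-Yorke chaotic if for every increasing sequence $\{F_n\}_{n\ge1}$ of compact subsets of $T$ there is an uncountable dense set $\Theta\subseteq X$ such that for any distinct $x,y\in\Theta$ there are sequences $\{s_n\},\{t_n\}$ in $T$ and a point $p\in X$ with $s_n\notin F_n$ for all $n$, $s_n(x,y)\to(x,y)$ and $t_n(x,y)\to(p,p)$ as $n\to\infty$. *)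

(* Defs.v *)
From HB Require Import structures.
From mathcomp Require Import all_boot all_order all_algebra.
From mathcomp Require Import all_classical all_reals all_analysis.

Set Implicit Arguments.
Unset Strict Implicit.
Unset Printing Implicit Defensive.

Import Order.TTheory GRing.Theory Num.Theory.

Local Open Scope classical_set_scope.
Local Open Scope ring_scope.

HB.structure Definition PreTopologicalSemigroup :=
  {T of Topological T & Semigroup T}.

HB.mixin Record PreTopologicalSemigroup_isTopologicalSemigroup T
    & PreTopologicalSemigroup T := {
  mulg_continuous : continuous (fun st : T * T => (st.1 * st.2)%g) }.

#[short(type="topologicalSemigroupType")]
HB.structure Definition TopologicalSemigroup :=
  {T of PreTopologicalSemigroup T
      & PreTopologicalSemigroup_isTopologicalSemigroup T}.

#[short(type="discreteSemigroupType")]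
HB.structure Definition DiscreteSemigroup :=
  {T of TopologicalSemigroup T & DiscreteTopology T}.

(* Polishness is a property of the topology: the complete metric is not part of
   the structure on X. *)
Definition is_metric (R : realType) (X : Type) (d : X -> X -> R) :=
  [/\ forall x y, 0 <= d x y,
      forall x y, d x y = 0 <-> x = y,
      forall x y, d x y = d y x
    & forall x y z, d x z <= d x y + d y z].

Definition induces_topology (R : realType) (X : topologicalType)
    (d : X -> X -> R) :=
  forall (x : X) (A : set X),
    nbhs x A <-> exists2 e : R, 0 < e & [set y | d x y < e] `<=` A.

Definition complete_metric (R : realType) (X : topologicalType)
    (d : X -> X -> R) :=
  forall u : nat -> X,
    (forall e : R, 0 < e -> exists N : nat, forall m n : nat,
       (N <= m)%N -> (N <= n)%N -> d (u m) (u n) < e) ->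
    exists l : X, u n @[n --> \oo] --> l.

Definition separable_space (X : topologicalType) :=
  exists2 D : set X, countable D & dense D.

Definition polish_space (R : realType) (X : topologicalType) :=
  separable_space X /\
  exists d : X -> X -> R,
    [/\ is_metric d, induces_topology d & complete_metric d].

Record semiflow (T : topologicalSemigroupType) (X : topologicalType) := Semiflow {
  flow_act :> T -> X -> X ;
  flow_continuous : continuous (fun tx : T * X => flow_act tx.1 tx.2) ;
  flow_comp : forall (s t : T) (x : X),
    flow_act s (flow_act t x) = flow_act (s * t)%g x ;
  flow_neutral : forall e : T,
    (forall t : T, (e * t)%g = t /\ (t * e)%g = t) ->
    forall x : X, flow_act e x = x }.

Section Semiflows.
Context {T : topologicalSemigroupType} {X : topologicalType}.
Variable phi : semiflow T X.

Definition hitting_times (U V : set X) : set T :=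
  [set t | U `&` phi t @^-1` V !=set0].

Definition weakly_mixing := forall U V U' V' : set X,
  open U -> open V -> open U' -> open V' ->
  U !=set0 -> V !=set0 -> U' !=set0 -> V' !=set0 ->
  hitting_times U V `&` hitting_times U' V' !=set0.

Definition diag_act (t : T) (z : X * X) : X * X := (phi t z.1, phi t z.2).

Definition densely_2D_LiYorke_chaotic := forall F : nat -> set T,
  (forall n, compact (F n)) -> (forall n, F n `<=` F n.+1) ->
  exists Theta : set X, [/\ ~ countable Theta, dense Theta &
    forall x y : X, Theta x -> Theta y -> x <> y ->
    exists (s t : nat -> T) (p : X),
      [/\ forall n, ~ F n (s n),
          diag_act (s n) (x, y) @[n --> \oo] --> (x, y)
        & diag_act (t n) (x, y) @[n --> \oo] --> (p, p)]].

End Semiflows.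

(* Main.v *)
Require Import Defs.
From mathcomp Require Import finmap summability.
From mathcomp Require Import all_boot all_order all_algebra.
From mathcomp Require Import all_classical all_reals all_analysis.
From mathcomp Require Import lra.

Set Implicit Arguments.
Unset Strict Implicit.
Unset Printing Implicit Defensive.

Import Order.TTheory GRing.Theory Num.Theory.
Import numFieldNormedType.Exports.

Local Open Scope classical_set_scope.
Local Open Scope ring_scope.

(** Two relations on X are shown to be generic in X * X: returning close to
    itself at a time outside the prescribed compact set, and being pushed
    arbitrarily close to one fixed point p.  A set of Mycielski type, that is,
    an uncountable dense set all of whose off-diagonal pairs are generic, is
    then the scrambled set.

    Genericity of the second relation is weak mixing applied to the pairs
    (U, W), (V, W) with W a ball around p.  For the first one the times in a
    compact, hence finite, set K have to be avoided although T need not be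
    commutative.  A weakly mixing space with two points has no isolated point,
    so a nonempty open U contains x and y with y outside the finite set K x.
    Small neighbourhoods U1 of x and U2 of y then satisfy t U1 `&` U2 = set0
    for every t in K, so any common element of N(U1, U2) and N(V, V) lies
    outside K and belongs to both N(U, U) and N(V, V): this is
    [return_times_outside_compact].

    The Mycielski set comes from Zorn's lemma instead of a Cantor scheme.  By
    the argument of Kuratowski and Ulam, the points x whose sections are all
    residual form a residual set ([residual_generic]).  By Baire's theorem, a
    countable independent set of such points can be enlarged inside any given
    nonempty open set ([independent_extend]).  Iterating over a countable
    pi-base yields a countable dense independent set, and a maximal
    independent set that contains it cannot be countable ([mycielski]). *)

(** * Residual sets *)

Section Residual.
Context {X : topologicalType}.
Implicit Types (A B : set X).

Definition residual A := exists G : nat -> set X,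
  (forall n, open (G n) /\ dense (G n)) /\ \bigcap_n G n `<=` A.

Definition baire_space := forall A, residual A -> dense A.

Lemma sub_residual A B : A `<=` B -> residual A -> residual B.
Proof. by move=> AB [G [Gn GA]]; exists G; split=> // x /GA/AB. Qed.

Lemma residual_open_dense A : open A -> dense A -> residual A.
Proof. by move=> oA dA; exists (fun=> A); split=> // x /(_ 0%N I). Qed.

Lemma residualT : residual setT.
Proof.
apply: residual_open_dense; first exact: openT.
by move=> U [x Ux] _; exists x.
Qed.

Lemma residual_bigcap_nat (A : nat -> set X) :
  (forall n, residual (A n)) -> residual (\bigcap_n A n).
Proof.
move=> /choice[G GA].
pose k n := odflt (0%N, 0%N) (unpickle n).
exists (fun n => G (k n).1 (k n).2); split=> [n|x Gx i _].
  by have [/(_ (k n).2)] := GA (k n).1.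
apply: (proj2 (GA i)) => j _.
by have := Gx (pickle (i, j)) I; rewrite /k pickleK.
Qed.

Lemma residual_bigcap I (D : set I) (A : I -> set X) : countable D ->
  (forall i, D i -> residual (A i)) -> residual (\bigcap_(i in D) A i).
Proof.
move=> /pfcard_geP[-> _|[q] AD]; first by rewrite bigcap_set0; exact: residualT.
have /residual_bigcap_nat : forall n, residual (A (q n)).
  by move=> n; apply/AD/(@funS _ _ _ _ q).
apply: sub_residual => x Ax i Di.
by have [n _ <-] := @surj _ _ _ _ q i Di; exact: Ax.
Qed.

Lemma residualI A B : residual A -> residual B -> residual (A `&` B).
Proof.
move=> rA rB; have : residual (\bigcap_(b in [set: bool]) if b then A else B).
  by apply: residual_bigcap => [|[]] //; exact: countableP.
by apply: sub_residual => x AB; split; [apply: (AB true)|apply: (AB false)].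
Qed.

End Residual.
Arguments baire_space : clear implicits.

(** * Dense uncountable independent sets *)

Section Mycielski.
Context {X : topologicalType}.
Variables (B : nat -> set X) (O : nat -> X -> X -> Prop).
Hypotheses (X_baire : baire_space X)
  (residualC1 : forall x : X, residual [set~ x])
  (open_B : forall n, open (B n)) (B0 : forall n, B n !=set0)
  (B_pi_base : forall U : set X, open U -> U !=set0 -> exists n, B n `<=` U)
  (O_open : forall n y, open [set x | O n x y])
  (O_sym : forall n x y, O n x y -> O n y x)
  (O_dense : forall n (U V : set X), open U -> open V -> U !=set0 -> V !=set0 ->
    exists x y, [/\ U x, V y & O n x y]).

(** The Kuratowski-Ulam sections.  Openness of [O n] in each variable separately
    is enough: a projection of [O n] is a union of sections, and no product
    neighbourhood is ever used. *)
Definition generic : set X := [set x | forall n, residual [set y | O n y x]].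

(** Projecting the part of [O n] above a member of the pi-base to the first
    factor gives a dense open set.  A point in all these countably many
    projections has dense sections. *)
Lemma residual_generic : residual generic.
Proof.
pose G nm : set X := [set x | exists2 y, B nm.2 y & O nm.1 x y].
have : residual (\bigcap_(nm in [set: nat * nat]) G nm).
  apply: residual_bigcap => [|[n m] _]; first exact: countableP.
  apply: residual_open_dense.
    have -> : G (n, m) = \bigcup_(y in B m) [set x | O n x y].
      by apply/seteqP; split=> x [y]; exists y.
    by apply: bigcup_open => y _; exact: O_open.
  move=> U U0 oU.
  have [x [y [Ux By Oxy]]] := O_dense n oU (open_B m) U0 (B0 m).
  by exists x; split=> //; exists y.
apply: sub_residual => x Gx n; apply: residual_open_dense; first exact: O_open.
move=> V V0 oV; have [m BV] := B_pi_base oV V0.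
by have [y /BV Vy /O_sym Oyx] := Gx (n, m) I; exists y.
Qed.

(** Requiring the points to be generic is what keeps an independent set
    extendable: independence alone does not make the sections residual. *)
Definition independent (A : set X) := A `<=` generic /\
  forall x y, A x -> A y -> x <> y -> forall n, O n x y.

Lemma independent_extend (A U : set X) : independent A -> countable A ->
  open U -> U !=set0 ->
  exists x, [/\ U x, ~ A x & independent (x |` A)].
Proof.
move=> [Agen AO] cA oU U0.
have /X_baire/(_ U U0 oU) : residual (generic `&`
    \bigcap_(y in A) ([set~ y] `&` \bigcap_n [set x | O n x y])).
  apply: residualI; first exact: residual_generic.
  apply: residual_bigcap => // y Ay; apply: residualI => //.
  by apply: residual_bigcap_nat => n; exact: Agen.
move=> [x [Ux [gx xA]]]; exists x; split=> // [Ax|].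
  by have [/(_ erefl)] := xA _ Ax.
split=> [y [->|/Agen]//|y z [->|Ay] [->|Az] //] yz n.
- by have [_ /(_ n I)] := xA _ Az.
- by apply: O_sym; have [_ /(_ n I)] := xA _ Ay.
- exact: AO.
Qed.

Lemma independent_bigcup (C : set (set X)) :
  C `<=` independent -> total_on C subset -> independent (\bigcup_(A in C) A).
Proof.
move=> Cind Ctot; split=> [x [A /Cind[+ _]]|x y [A CA Ax] [A' CA' Ay]]; first exact.
have [AA'|A'A] := Ctot _ _ CA CA'.
- by apply: (Cind _ CA').2 => //; exact: AA'.
- by apply: (Cind _ CA).2 => //; exact: A'A.
Qed.

(** One point is added in each member of the pi-base.  The construction starts
    from arbitrary sets, the hypotheses on them being carried by the step, so
    that it can be iterated by a plain recursion. *)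
Lemma countable_dense_independent :
  exists D : set X, [/\ countable D, dense D & independent D].
Proof.
have step (nA : nat * set X) : exists A', nA.2 `<=` A' /\
    (countable nA.2 -> independent nA.2 ->
     [/\ countable A', independent A' & A' `&` B nA.1 !=set0]).
  case: nA => n A /=; have [[cA iA]|nA] := pselect (countable A /\ independent A).
    have [x [Bx _ ixA]] := independent_extend iA cA (@open_B n) (B0 n).
    exists (x |` A); split=> [y ?|_ _]; first by right.
    split=> //; last by exists x; split=> //; left.
    pose F (b : bool) := if b then [set x] else A.
    have -> : x |` A = \bigcup_(b in setT) F b.
      apply/seteqP; split=> [y [xy|Ay]|y [[] _ Fy]]; first by exists true.
      - by exists false.
      - by left.
      - by right.
    by apply: bigcup_countable => // -[] _ //; exact: countable1.
  by exists A; split=> // cA iA; exfalso; apply: nA.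
have [f fP] := choice step.
pose S := fix S n := if n is m.+1 then f (m, S m) else set0.
have SP n : countable (S n) /\ independent (S n).
  elim: n => [|n [cS iS]] /=; first by split; [exact: countable0|split].
  by have [_ /(_ cS iS)[]] := fP (n, S n).
have Smono m n : (m <= n)%N -> S m `<=` S n.
  elim: n => [|n IH]; first by rewrite leqn0 => /eqP->.
  rewrite leq_eqVlt => /predU1P[->//|]; rewrite ltnS => /IH Smn x /Smn.
  exact: (fP (n, S n)).1.
exists (\bigcup_(A in range S) A); split.
- apply: bigcup_countable => [|A [n _ <-]]; last exact: (SP n).1.
  by apply: card_le_trans (card_image_le _ _) _; exact: countableP.
- move=> U U0 oU; have [n BU] := B_pi_base oU U0.
  have [cS iS] := SP n.
  have [_ /(_ cS iS)[_ _ [x [Sx Bx]]]] := fP (n, S n).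
  by exists x; split; [exact: BU|exists (S n.+1) => //; exists n.+1].
- apply: independent_bigcup => [A [n _ <-]|_ _ [m _ <-] [n _ <-]].
    exact: (SP n).2.
  by have [/Smono|/ltnW/Smono] := leqP m n; [left|right].
Qed.

(** Zorn's lemma is applied to the sets A for which [D `|` A] is independent,
    with D countable, dense and independent; the maximal union is dense because
    of D, and uncountable because a countable one would be extendable. *)
Lemma mycielski : exists Theta : set X, [/\ ~ countable Theta, dense Theta &
  forall x y, Theta x -> Theta y -> x <> y -> forall n, O n x y].
Proof.
have [D [cD dD iD]] := countable_dense_independent.
have [|A [iDA Amax]] := @Zorn_bigcup X [set A | independent (D `|` A)].
  move=> C Cind Ctot /=.
  (* D is added to the chain so that the empty chain is covered. *)
  have -> : D `|` \bigcup_(A in C) A =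
      \bigcup_(A' in D |` [set D `|` A | A in C]) A'.
    apply/seteqP; split=> x.
      move=> [Dx|[A CA Ax]]; first by exists D => //; left.
      by exists (D `|` A); [right; exists A|right].
    move=> [_ [->|[A CA <-]]]; first by left.
    by move=> [Dx|Ax]; [left|right; exists A].
  apply: independent_bigcup => [_ [->|[A /Cind ? <-]] //|].
  move=> _ _ [->|[A CA <-]] [->|[A' CA' <-]]; [by left| | |].
  - by left=> x; left.
  - by right=> x; left.
  - by have [AA'|A'A] := Ctot _ _ CA CA'; [left|right]; apply: setUS.
exists (D `|` A); split.
- move=> cDA.
  have [x [_ xDA ixDA]] := independent_extend iDA cDA (@open_B 0) (B0 0).
  apply: (Amax (x |` A)); last by rewrite /= setUCA.
  split=> [y ?|]; first by right.
  by move=> /(_ x (or_introl erefl)) Ax; apply: xDA; right.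
- by move=> U U0 oU; have [x [Ux Dx]] := dD U U0 oU; exists x; split=> //; left.
- exact: iDA.2.
Qed.

End Mycielski.

(** * Metrizable spaces *)

Section Metric.
Context {R : realType} {X : topologicalType} (d : X -> X -> R).
Hypotheses (d_metric : is_metric d) (d_top : induces_topology d).

Let d_sym x y : d x y = d y x. Proof. by case: d_metric. Qed.
Let d_tri x y z : d x z <= d x y + d y z. Proof. by case: d_metric. Qed.
Let d0 x : d x x = 0. Proof. by case: d_metric => _ d0 _ _; exact/d0. Qed.

Lemma dist_gt0 x y : x <> y -> 0 < d x y.
Proof.
case: d_metric => dge0 deq0 _ _ xy; rewrite lt_neqAle dge0 andbT.
by apply/eqP => /esym/deq0.
Qed.

Lemma nbhs_dist_lt x e : 0 < e -> \forall y \near x, d x y < e.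
Proof. by move=> e0; apply/d_top; exists e. Qed.

Lemma continuous_dist (Z : topologicalType) (f g : Z -> X) :
  continuous f -> continuous g -> continuous (fun z => d (f z) (g z) : R).
Proof.
move=> cf cg z; apply/cvgrPdist_lt => e e0.
have e2 : 0 < e / 2 by lra.
near=> z'.
have hf : d (f z) (f z') < e / 2.
  by near: z'; exact: (cf z _ (nbhs_dist_lt (f z) e2)).
have hg : d (g z) (g z') < e / 2.
  by near: z'; exact: (cg z _ (nbhs_dist_lt (g z) e2)).
have h1 := d_tri (f z) (f z') (g z); have h2 := d_tri (f z') (g z') (g z).
have h3 := d_tri (f z') (f z) (g z'); have h4 := d_tri (f z) (g z) (g z').
rewrite (d_sym (g z') (g z)) in h2; rewrite (d_sym (f z') (f z)) in h3.
rewrite ltr_norml; apply/andP; split; lra.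
Unshelve. all: by end_near. Qed.

Lemma open_dist_lt (Z : topologicalType) (f g : Z -> X) e :
  continuous f -> continuous g -> open [set z | d (f z) (g z) < e].
Proof.
move=> cf cg; have := continuous_dist cf cg.
by move=> /continuousP/(_ _ (@open_lt R e)).
Qed.

Lemma open_dist_ball x e : open [set y | d x y < e].
Proof.
by apply: (@open_dist_lt _ (cst x) id) => y; [exact: cvg_cst|exact: cvg_id].
Qed.

Lemma open_neq (Z : topologicalType) (f g : Z -> X) :
  continuous f -> continuous g -> open [set z | f z <> g z].
Proof.
move=> cf cg; have /continuousP/(_ _ (@open_gt R 0)) := continuous_dist cf cg.
congr (open _); apply/seteqP; split=> z /=; last exact: dist_gt0.
by move=> + fg; rewrite fg d0 ltxx.
Qed.

Lemma cvg_dist (u : nat -> X) l :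
  (forall n, d l (u n) < n.+1%:R^-1) -> u n @[n --> \oo] --> l.
Proof.
move=> ul A /d_top[e e0 eA].
have := near_infty_natSinv_lt (PosNum e0).
apply: filterS => n /= ne; apply: eA => /=.
exact: lt_trans (ul n) ne.
Qed.

(** The Baire category theorem, by nested closed balls.  The point lies in each
    [G n] because the closed ball of rank [n.+1] is chosen inside it. *)
Lemma complete_metric_baire : complete_metric d -> baire_space X.
Proof.
move=> d_complete A [G [Gn GA]] U [x0 Ux0] oU.
have shrink (V : set X) x r : open V -> V x -> 0 < r -> exists2 r', 0 < r' < r &
    [set y | d x y <= r'] `<=` V.
  move=> oV Vx r0; have /d_top[e e0 eV] := open_nbhs_nbhs (conj oV Vx).
  exists (Num.min e r / 2).
    by have [er|re] := ltP e r; apply/andP; split; lra.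
  move=> y /= xy; apply: eV => /=; apply: le_lt_trans xy _.
  by have [er|re] := ltP e r; lra.
have step (nc : nat * (X * R)) : exists c' : X * R, 0 < nc.2.2 ->
    0 < c'.2 < nc.1.+1%:R^-1 /\ [set y | d c'.1 y <= c'.2] `<=`
      G nc.1 `&` [set y | d nc.2.1 y < nc.2.2].
  case: nc => n [x r] /=; have [r0|_] := boolP (0 < r); last by exists (x, r).
  pose V := [set y | d x y < r].
  have oV : open V by exact: open_dist_ball.
  have [oG dG] := Gn n.
  have [||y [Vy Gy]] := dG V => //; first by exists x; rewrite /V /= d0.
  (* The bound on the radius forces the centres to form a Cauchy sequence. *)
  have [r' r'P r'V] := shrink (G n `&` V) y n.+1%:R^-1 (openI oG oV)
    (conj Gy Vy) (ltac:(by rewrite invr_gt0)).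
  by exists (y, r').
have [f fP] := choice step.
have [r0 r0P r0U] := shrink U x0 1 oU Ux0 ltr01.
pose c := fix c n : X * R := if n is m.+1 then f (m, c m) else (x0, r0).
have c_gt0 n : 0 < (c n).2.
  elim: n => [|n IH] /=; first by case/andP: r0P.
  by have [/andP[]] := fP (n, c n) IH.
have cS n : (c n.+1).2 < n.+1%:R^-1.
  by have [/andP[]] := fP (n, c n) (c_gt0 n).
pose K n := [set y | d (c n).1 y <= (c n).2].
have KS n : K n.+1 `<=` G n `&` K n.
  move=> y /(fP (n, c n) (c_gt0 n)).2[Gy /ltW]; by split.
have Kmono m n : (m <= n)%N -> K n `<=` K m.
  elim: n => [|n IH]; first by rewrite leqn0 => /eqP->.
  rewrite leq_eqVlt => /predU1P[->//|]; rewrite ltnS => /IH Knm x /KS[_ /Knm].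
  exact.
have Kc m n : (m <= n)%N -> d (c m).1 (c n).1 <= (c m).2.
  by move=> mn; apply: (Kmono _ _ mn); rewrite /K /= d0 ltW.
have [e e0|l cl] := d_complete (fun n => (c n).1).
  have e2 : 0 < e / 2 by lra.
  have [N _ /(_ N (leqnn N)) /= Ne] := near_infty_natSinv_lt (PosNum e2).
  exists N.+1 => m n /Kc Nm /Kc Nn.
  have := d_tri (c m).1 (c N.+1).1 (c n).1; rewrite (d_sym (c m).1 (c N.+1).1).
  have := lt_trans (cS N) Ne; lra.
have Kl n : K n l.
  apply/ler_addgt0Pr => e e0.
  have [N _ Nl] := cl _ (nbhs_dist_lt l e0).
  have := Nl (maxn N n) (leq_maxl _ _); have := Kc _ _ (leq_maxr N n).
  have := d_tri (c n).1 (c (maxn N n)).1 l.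
  rewrite /= (d_sym (c (maxn N n)).1 l); lra.
exists l; split; first by apply: r0U; exact: (Kl 0%N).
by apply: GA => n _; have /KS[] := Kl n.+1.
Qed.

Lemma separable_pi_base (x0 : X) : separable_space X -> exists B : nat -> set X,
  [/\ forall n, open (B n), forall n, B n !=set0 &
      forall U : set X, open U -> U !=set0 -> exists n, B n `<=` U].
Proof.
move=> [D + dD] => /pfcard_geP[D0|[q]].
  by have [|x []] := dD setT _ openT; [exists x0|rewrite D0].
pose k n := odflt (0%N, 0%N) (unpickle n).
exists (fun n => [set y | d (q (k n).1) y < (k n).2.+1%:R^-1]); split=> [n|n|].
- exact: open_dist_ball.
- by exists (q (k n).1); rewrite /= d0 invr_gt0.
- move=> U oU [x Ux]; have /d_top[e e0 eU] := open_nbhs_nbhs (conj oU Ux).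
  have e2 : 0 < e / 2 by lra.
  have [N _ /(_ N (leqnn N)) /= Ne] := near_infty_natSinv_lt (PosNum e2).
  have [||y [/= xy Dy]] := dD [set y | d x y < N.+1%:R^-1].
  + by exists x; rewrite /= d0 invr_gt0.
  + exact: open_dist_ball.
  have [i _ qi] := @surj _ _ _ _ q y Dy.
  exists (pickle (i, N)) => z; rewrite /= /k pickleK /= qi => yz; apply: eU => /=.
  have := d_tri x y z; have := lt_trans xy Ne; have := lt_trans yz Ne; lra.
Qed.

End Metric.

(** * Return times of weakly mixing semiflows *)

(** Every point t of K is eventually in B along the filter of large finite sets
    B, and in a discrete space this is uniform near t; compactness makes it
    uniform on K. *)
Lemma compact_discrete_finite (T : discreteTopologicalType) (K : set T) :
  compact K -> finite_set K.
Proof.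
move=> /compact_near_coveringP cK.
have [|B _ /(_ B (fsubset_refl _)) KB] :=
    cK {fset T} totally (fun B t => t \in B) (@filter_filter _ _ totally_filter).
  move=> t _; exists ([set t], [set B : {fset T} | t \in B]).
    split; first by apply: open_nbhs_nbhs; split; [exact: discrete_open|].
    by exists [fset t]%fset => // B /=; rewrite fsub1set.
  by move=> [_ B] [/= ->].
exact: sub_finite_set KB (finite_fset B).
Qed.

Section Flow.
Context {R : realType} {T : discreteSemigroupType} {X : topologicalType}.
Variables (phi : semiflow T X) (d : X -> X -> R).
Hypotheses (phi_wm : weakly_mixing phi) (d_metric : is_metric d)
  (d_top : induces_topology d) (X_nonsingleton : exists x y : X, x <> y).

Lemma flow_act_continuous t : continuous (phi t).
Proof.
move=> x; have ctx : (t, x') @[x' --> x] --> (t, x).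
  by apply: cvg_pair; [exact: cvg_cst|exact: cvg_id].
exact: (cvg_comp _ _ ctx (@flow_continuous _ _ phi (t, x))).
Qed.

(** If x were isolated, one time would send x close to each of two distinct
    points. *)
Lemma dense_setC1 (x : X) : dense [set~ x].
Proof.
have [a [b ab]] := X_nonsingleton.
move=> U [u Uu] oU; apply: contrapT => UC.
have Ux y : U y -> y = x.
  by move=> Uy; apply: contrapT => yx; apply: UC; exists y.
have r0 : 0 < d a b / 2 by rewrite divr_gt0// (dist_gt0 d_metric).
have d0 y : d y y = 0 by case: d_metric => _ dP _ _; apply/dP.
have [||||||||t [[y [/Ux -> ta]] [z [/Ux -> tb]]]] :=
  @phi_wm U [set y | d a y < d a b / 2] U [set y | d b y < d a b / 2] => //.
- exact: open_dist_ball.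
- exact: open_dist_ball.
- by exists u.
- by exists a; rewrite /= d0.
- by exists u.
- by exists b; rewrite /= d0.
case: d_metric => _ _ dsym dtri; have := dtri a (phi t x) b.
move: ta tb; rewrite /= (dsym b); lra.
Qed.

Lemma residual_setC1 (x : X) : residual [set~ x].
Proof.
apply: residual_open_dense; last exact: dense_setC1.
by apply: (@open_neq _ _ _ d_metric d_top _ id (cst x)) => y;
  [exact: cvg_id|exact: cvg_cst].
Qed.

(** Weak mixing is applied to (U1, U2) and (V, V), where U1 and U2 are parts of
    U that no element of K connects. *)
Lemma return_times_outside_compact (K : set T) (U V : set X) :
  baire_space X -> compact K ->
  open U -> open V -> U !=set0 -> V !=set0 ->
  exists t, [/\ ~ K t, hitting_times phi U U t & hitting_times phi V V t].
Proof.
move=> X_baire cK oU oV [x Ux] V0.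
have [y [Uy yK]] : U `&` \bigcap_(t in K) [set~ phi t x] !=set0.
  apply: X_baire => //; last by exists x.
  apply: residual_bigcap => [|t _]; last exact: residual_setC1.
  exact/finite_set_countable/compact_discrete_finite.
(* Joint continuity makes the choice of neighbourhoods uniform over K. *)
have [[W1 W2] [/= nW1 nW2] W12] : \forall z \near (x, y),
    forall t, K t -> phi t z.1 <> z.2.
  have /compact_near_coveringP cover_K := cK.
  apply: (cover_K _ (nbhs (x, y)) (fun z t => phi t z.1 <> z.2) _) => t Kt.
  have : nbhs (t, (x, y)) [set tz | phi tz.1 tz.2.1 <> tz.2.2].
    apply: open_nbhs_nbhs; split; last by move=> /= txy; apply: (yK t).
    apply: (@open_neq _ _ _ d_metric d_top _ (fun tz => phi tz.1 tz.2.1)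
      (fun tz => tz.2.2)) => tz.
      have ctz : (tz'.1, tz'.2.1) @[tz' --> tz] --> (tz.1, tz.2.1).
        apply: cvg_pair; first exact: cvg_fst.
        exact: (cvg_comp _ _ cvg_snd cvg_fst).
      exact: (cvg_comp _ _ ctz (@flow_continuous _ _ phi (tz.1, tz.2.1))).
    exact: (cvg_comp _ _ cvg_snd cvg_snd).
  exact.
have [||||||||s [[u [[Uu W1u] [Usu W2su]]] [v Vv]]] :=
  @phi_wm (U `&` W1°) (U `&` W2°) V V => //.
- exact/openI/open_interior.
- exact/openI/open_interior.
- by exists x.
- by exists y.
exists s; split; [|by exists u|by exists v].
by move=> Ks; apply: (W12 (u, phi s u) _ s) => //; split; exact: interior_subset.
Qed.

(** The point p is fixed in advance because the target of the proximal times
    must not vary with the scale n; weak mixing even allows one p for all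
    pairs. *)
Definition near_LiYorke (p : X) (K : set T) (n : nat) (x y : X) :=
  (exists s, [/\ ~ K s, d x (phi s x) < n.+1%:R^-1 &
                 d y (phi s y) < n.+1%:R^-1]) /\
  (exists t, d p (phi t x) < n.+1%:R^-1 /\ d p (phi t y) < n.+1%:R^-1).

Lemma near_LiYorke_sym p K n x y :
  near_LiYorke p K n x y -> near_LiYorke p K n y x.
Proof.
by move=> [[s [Ks xs ys]] [t [xt yt]]]; split; [exists s|exists t].
Qed.

Lemma open_near_LiYorke p K n y : open [set x | near_LiYorke p K n x y].
Proof.
have -> : [set x | near_LiYorke p K n x y] =
  (\bigcup_(s in [set s | ~ K s /\ d y (phi s y) < n.+1%:R^-1])
    [set x | d x (phi s x) < n.+1%:R^-1]) `&`
  (\bigcup_(t in [set t | d p (phi t y) < n.+1%:R^-1])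
    [set x | d p (phi t x) < n.+1%:R^-1]).
  apply/seteqP; split=> x.
    by move=> [[s [Ks xs ys]] [t [xt yt]]]; split; [exists s|exists t].
  by move=> [[s [Ks ys] xs] [t yt xt]]; split; [exists s|exists t].
have cphi := flow_act_continuous.
apply: openI; apply: bigcup_open => s _.
  by apply: (@open_dist_lt _ _ _ d_metric d_top _ id) => // x; exact: cvg_id.
by apply: (@open_dist_lt _ _ _ d_metric d_top _ (cst p)) => // x; exact: cvg_cst.
Qed.

(** A common time t first brings parts of U and V near p; the return times are
    then taken for small neighbourhoods inside these parts. *)
Lemma dense_near_LiYorke p K n (U V : set X) :
  baire_space X -> compact K -> open U -> open V -> U !=set0 -> V !=set0 ->
  exists x y, [/\ U x, V y & near_LiYorke p K n x y].
Proof.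
move=> X_baire cK oU oV U0 V0; pose e : R := n.+1%:R^-1.
have e0 : 0 < e by rewrite invr_gt0.
have e2 : 0 < e / 2 by rewrite divr_gt0.
have oball x r : open [set y | d x y < r] by exact: open_dist_ball.
have ball_center x (r : R) : 0 < r -> d x x < r.
  by case: d_metric => _ dP _ _; rewrite (proj2 (dP x x) erefl).
pose W := [set z | d p z < e].
have W0 : W !=set0 by exists p; exact: ball_center.
have [t [[u [Uu tu]] [v [Vv tv]]]] :=
  phi_wm oU (oball _ _ : open W) oV (oball _ _ : open W) U0 W0 V0 W0.
pose U1 := U `&` phi t @^-1` W `&` [set y | d u y < e / 2].
pose V1 := V `&` phi t @^-1` W `&` [set y | d v y < e / 2].
have oW : open (phi t @^-1` W).
  by have /continuousP := @flow_act_continuous t; apply; exact: oball.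
have oU1 : open U1 by do 2![apply: openI => //].
have oV1 : open V1 by do 2![apply: openI => //].
have [||s [Ks]] := return_times_outside_compact X_baire cK oU1 oV1.
- by exists u; split=> //; exact: ball_center.
- by exists v; split=> //; exact: ball_center.
move=> [x [[[Ux tx] ux] [_ usx]]] [y [[[Vy ty] vy] [_ vsy]]].
have close (w z z' : X) : d w z < e / 2 -> d w z' < e / 2 -> d z z' < e.
  case: d_metric => _ _ dsym dtri; have := dtri z w z'; rewrite (dsym z w).
  lra.
exists x, y; split=> //; split; last by exists t.
by exists s; split=> //; [exact: close ux usx|exact: close vy vsy].
Qed.

End Flow.

(** * Dense Li-Yorke chaos *)

Theorem proposition3p12 (R : realType) (T : discreteSemigroupType)
  (X : topologicalType) (phi : semiflow T X)
  (X_polish : polish_space R X) (X_nonsingleton : exists x y : X, x <> y)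
  (phi_wm : weakly_mixing phi) :
  densely_2D_LiYorke_chaotic phi.
Proof.
move=> F cF _.
have [X_sep [d [d_metric d_top d_complete]]] := X_polish.
have X_baire := complete_metric_baire d_metric d_top d_complete.
have [p _] := X_nonsingleton.
have [B [oB B0 B_base]] := separable_pi_base d_metric d_top p X_sep.
have [M [uncM dM OM]] := mycielski X_baire
  (residual_setC1 phi_wm d_metric d_top X_nonsingleton) oB B0 B_base
  (fun n => open_near_LiYorke phi d_metric d_top p (F n) n)
  (fun n x y => @near_LiYorke_sym _ _ _ phi d p (F n) n x y)
  (fun n U V => dense_near_LiYorke phi_wm d_metric d_top X_nonsingleton p n
     X_baire (cF n)).
exists M; split=> // x y Tx Ty xy.
have Oxy n := OM x y Tx Ty xy n.
have [s sP] := choice (fun n => (Oxy n).1).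
have [t tP] := choice (fun n => (Oxy n).2).
exists s, t, p; split=> [n||]; first by case: (sP n).
- by apply: cvg_pair; apply: (cvg_dist d_top) => n; case: (sP n).
- by apply: cvg_pair; apply: (cvg_dist d_top) => n; case: (tP n).
Qed.
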